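(* There is a constant $C$ such that for every sufficiently large $n$ there exists a $1$-planar graph of girth $5$ on $n$ vertices with at least $\left(2+\frac{1}{6}\right)n-C$ edges.
   Context: All graphs are finite and simple. A graph is $k$-planar if it admits a drawing in the plane in which every edge is crossed at most $k$ times. The girth of a graph is the length of its shortest cycle. (The paper states the edge count as $(2+\frac16)n-O(1)$.) *)

(* Defs.v *)
From mathcomp Require Import all_boot.
From Stdlib Require Import Reals.

Set Implicit Arguments.
Unset Strict Implicit.
Unset Printing Implicit Defensive.

Definition simple_graph (T : finType) (e : rel T) : Prop :=
  symmetric e /\ irreflexive e.

Definition has_cycle_of_length (T : finType) (e : rel T) (k : nat) : Prop :=
  exists s : seq T, [/\ size s = k, uniq s & cycle e s].

Definition girth_eq (T : finType) (e : rel T) (g : nat) : Prop :=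
  (3 <= g)%N /\ has_cycle_of_length e g /\
  (forall k, (3 <= k < g)%N -> ~ has_cycle_of_length e k).

Definition edge_of (n : nat) (e : rel 'I_n) (p : 'I_n * 'I_n) : bool :=
  (p.1 < p.2)%N && e p.1 p.2.

Definition num_edges (n : nat) (e : rel 'I_n) : nat :=
  #|[set p : 'I_n * 'I_n | edge_of e p]|.

Local Open Scope R_scope.

Definition continuous_curve (c : R -> R * R) : Prop :=
  forall t, continuity_pt (fun x => fst (c x)) t /\ continuity_pt (fun x => snd (c x)) t.

(* A drawing of the graph in the plane in which every edge is crossed at most
   k times: vertices are distinct points; each edge (u,v) is a simple arc
   arc p restricted to [0,1] from pos u to pos v, whose interior avoids all
   vertex points; a crossing of edge p is a pair (q, s) with q another edge
   and arc p s = arc q t an interior point of both arcs; each edge has at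
   most k crossings. *)
Definition k_planar_drawing (n : nat) (e : rel 'I_n) (k : nat)
    (pos : 'I_n -> R * R) (arc : 'I_n * 'I_n -> R -> R * R) : Prop :=
  (forall u v, pos u = pos v -> u = v) /\
  (forall p, edge_of e p ->
     continuous_curve (arc p) /\ arc p 0 = pos p.1 /\ arc p 1 = pos p.2 /\
     (forall s t, 0 <= s <= 1 -> 0 <= t <= 1 -> arc p s = arc p t -> s = t) /\
     (forall s w, 0 < s < 1 -> arc p s <> pos w)) /\
  (forall p, edge_of e p ->
     exists L : list (('I_n * 'I_n) * R),
       (List.length L <= k)%nat /\
       (forall q s t, edge_of e q -> q <> p -> 0 < s < 1 -> 0 < t < 1 ->
          arc p s = arc q t -> List.In (q, s) L)).

Definition k_planar (n : nat) (e : rel 'I_n) (k : nat) : Prop :=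
  exists pos arc, k_planar_drawing e k pos arc.

(* Main.v *)
(** The strip [[0,20] x R], with its vertical sides glued, is a cylinder, and
    [(X, Y) |-> exp Y * (cos (pi X / 10), sin (pi X / 10))] embeds it in the
    plane.  On the cylinder we take a vertical-translation-invariant
    straight-line drawing with 6 vertices and 13 edges per period: vertex
    [6 k + r] sits at [(vertex_x r, vertex_y r + 20 k)].  Restricting to the
    indices below [n] loses only boundedly many edges, those that leave the top
    of the drawing.  By translation invariance, girth and crossings reduce to
    finitely many integer computations. *)

Require Import Defs.
From mathcomp Require Import all_boot zify.
From Stdlib Require Import Reals Lra Classical.
From Stdlib Require List.

Set Implicit Arguments.
Unset Strict Implicit.
Unset Printing Implicit Defensive.

(** * The periodic drawing *)

(* The edges joining vertex [6 k + src] to vertex [6 (k + rise) + dst]; in the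
   universal cover of the cylinder they end [wind] turns further. *)
Record template := Template { src : nat; dst : nat; rise : nat; wind : Z }.

Definition templates : list template :=
  [:: Template 0 3 1 0; Template 0 5 0 0; Template 0 5 1 0; Template 1 4 0 0;
      Template 1 4 1 0; Template 1 5 0 (-1); Template 2 0 2 0; Template 2 3 1 0;
      Template 2 3 2 0; Template 2 4 1 0; Template 3 1 1 1; Template 4 2 1 0;
      Template 5 4 2 1].

Definition vertex_x (r : nat) : Z := nth 0%Z [:: 14; 5; 10; 13; 9; 15]%Z r.
(** Heights are not reduced modulo the period 20: adding 20 to one only renumbers its residue class,
    and this choice keeps every [rise] between 0 and 2. *)
Definition vertex_y (r : nat) : Z := nth 0%Z [:: 16; 48; 35; 2; 38; 2]%Z r.

Definition matches (a b : nat) (t : template) : bool :=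
  [&& a %% 6 == src t, b %% 6 == dst t & b %/ 6 == a %/ 6 + rise t].

Definition arrow (a b : nat) : bool := List.existsb (matches a b) templates.

Definition linked (a b : nat) : bool := arrow a b || arrow b a.

Definition template_of (a b : nat) : template :=
  odflt (Template 0 0 0 0) (List.find (matches a b) templates).

Lemma template_ofP a b : arrow a b ->
  List.In (template_of a b) templates /\ matches a b (template_of a b).
Proof.
rewrite /arrow /template_of => /List.existsb_exists [t [tin tm]].
case E: (List.find _ _) => [t'|] /=; first exact: List.find_some E.
by have := List.find_none _ _ E t tin; rewrite tm.
Qed.

(** Indices are ordered by period, then by residue, and every template with [rise] 0 goes to a
    larger residue. So templates orient edges as [edge_of] does. *)
Lemma arrow_lt a b : arrow a b -> a < b.
Proof.
have H : List.forallb (fun t => [&& src t < 6, dst t < 6 &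
    (0 < rise t) || (src t < dst t)]) templates by vm_compute.
move=> /List.existsb_exists [t [tin /and3P [/eqP ha /eqP hb /eqP hd]]].
move/List.forallb_forall: H => /(_ t tin); lia.
Qed.

Lemma linked_sym : symmetric linked.
Proof. by move=> a b; rewrite /linked orbC. Qed.

Lemma linked_irr : irreflexive linked.
Proof. by move=> a; rewrite /linked orbb; apply/negP => /arrow_lt; rewrite ltnn. Qed.

(** * Girth *)

(** The darts of the quotient graph on the six residues, with voltages in Z: a cycle of [linked]
    projects to a closed walk of total voltage 0. *)
Definition steps : list (nat * nat * Z) :=
  List.flat_map (fun t => [:: (src t, dst t, Z.of_nat (rise t));
                         (dst t, src t, (- Z.of_nat (rise t))%Z)]) templates.

Lemma linked_step a b : linked a b ->
  exists d, List.In (a %% 6, b %% 6, d) steps /\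
            Z.of_nat (b %/ 6) = (Z.of_nat (a %/ 6) + d)%Z.
Proof.
case/orP => /List.existsb_exists [t [tin /and3P [/eqP ha /eqP hb /eqP hd]]].
- exists (Z.of_nat (rise t)); split; last by lia.
  by apply/List.in_flat_map; exists t; split=> //; left; rewrite ha hb.
- exists (- Z.of_nat (rise t))%Z; split; last by lia.
  by apply/List.in_flat_map; exists t; split=> //; right; left; rewrite ha hb.
Qed.

Definition all_steps (P : nat -> nat -> Z -> bool) : bool :=
  List.forallb (fun s => P s.1.1 s.1.2 s.2) steps.

Lemma all_stepsP P : all_steps P ->
  forall u v d, List.In (u, v, d) steps -> P u v d.
Proof. by move=> /List.forallb_forall H u v d /H. Qed.

Lemma no_closed_walk3 : all_steps (fun u1 v1 d1 => all_steps (fun u2 v2 d2 =>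
  if u2 != v1 then true else all_steps (fun u3 v3 d3 =>
    ~~ [&& u3 == v2, v3 == u1 & Z.eqb (d1 + d2 + d3) 0]))).
Proof. by vm_compute. Qed.

Lemma linked_triangle_free a b c :
  linked a b -> linked b c -> linked c a -> False.
Proof.
move=> /linked_step [d1 [i1 e1]] /linked_step [d2 [i2 e2]] /linked_step [d3 [i3 e3]].
have := all_stepsP no_closed_walk3 i1 => /all_stepsP /(_ _ _ _ i2).
rewrite eqxx /= => /all_stepsP /(_ _ _ _ i3).
by rewrite !eqxx /=; lia.
Qed.

(** Exhaustive search. The two zero-sum guards discard the walks that backtrack at their second or
    third vertex, which are the cases [a = c] and [b = d] of a 4-cycle. *)
Lemma closed_walk4_degenerate :
  all_steps (fun u1 v1 d1 => all_steps (fun u2 v2 d2 =>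
    if u2 != v1 then true else if (v2 == u1) && Z.eqb (d1 + d2) 0 then true else
    all_steps (fun u3 v3 d3 =>
      if u3 != v2 then true else if (v3 == v1) && Z.eqb (d2 + d3) 0 then true else
      all_steps (fun u4 v4 d4 =>
        ~~ [&& u4 == v3, v4 == u1 & Z.eqb (d1 + d2 + d3 + d4) 0])))).
Proof. by vm_compute. Qed.

Lemma linked_square_free a b c d : a <> c -> b <> d ->
  linked a b -> linked b c -> linked c d -> linked d a -> False.
Proof.
move=> ac bd /linked_step [d1 [i1 e1]] /linked_step [d2 [i2 e2]].
move=> /linked_step [d3 [i3 e3]] /linked_step [d4 [i4 e4]].
have := all_stepsP closed_walk4_degenerate i1 => /all_stepsP /(_ _ _ _ i2).
rewrite eqxx /=; case: ifP => [/andP [/eqP]|_]; first by lia.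
move=> /all_stepsP /(_ _ _ _ i3); rewrite eqxx /=.
case: ifP => [/andP [/eqP]|_]; first by lia.
move=> /all_stepsP /(_ _ _ _ i4); rewrite !eqxx /=; lia.
Qed.

(** * Planar segments with integer end points *)

Section Segments.
Local Open Scope Z_scope.
Local Arguments Z.mul : simpl never.
Local Arguments Z.add : simpl never.

Definition seg_dx (t : template) := vertex_x (dst t) + 20 * wind t - vertex_x (src t).
Definition seg_dy (t : template) :=
  vertex_y (dst t) + 20 * Z.of_nat (rise t) - vertex_y (src t).

(* The cross products that give, by Cramer's rule, the parameters at which [t]
   meets the translate of [t'] by [k] periods upwards and [j] turns. *)
Definition seg_det t t' := seg_dx t * seg_dy t' - seg_dy t * seg_dx t'.
Definition seg_num t t' k j v :=
  (vertex_x (src t') + 20 * j - vertex_x (src t)) * seg_dy v -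
  (vertex_y (src t') + 20 * k - vertex_y (src t)) * seg_dx v.

(** Multiplying by [D] expresses 0 < s/D < 1 over the integers for either sign of [D]. Parallel
    segments count as soon as they lie on one line, which can only overestimate. *)
Definition hits t t' k j : bool :=
  let D := seg_det t t' in
  let s := seg_num t t' k j t' in let s' := seg_num t t' k j t in
  if D =? 0 then s' =? 0 else
  [&& 0 <? s * D, s * D <? D * D, 0 <? s' * D & s' * D <? D * D].

Definition passes t r k j : bool :=
  let cx := vertex_x r + 20 * j - vertex_x (src t) in
  let cy := vertex_y r + 20 * k - vertex_y (src t) in
  [&& seg_dx t * cy =? seg_dy t * cx, 0 <? cy * seg_dy t
    & cy * seg_dy t <? seg_dy t * seg_dy t].

(** Heights differ by at most 76 < 4 * 20 and abscissas by at most 34 < 2 * 20, so only these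
    relative translates can meet. *)
Definition shifts : list (Z * Z) :=
  List.list_prod [:: -3; -2; -1; 0; 1; 2; 3] [:: -1; 0; 1].

Definition same_key t t' : bool :=
  [&& src t == src t', dst t == dst t' & rise t == rise t'].

(** The same key with [k = 0] is the same edge of the cylinder, whatever the turn [j]; that an arc
    does not meet itself is shown separately. *)
Definition crossings t : list (template * (Z * Z)) :=
  List.filter (fun '(t', (k, j)) => ~~ (same_key t t' && (k =? 0)) && hits t t' k j)
    (List.list_prod templates shifts).

(** Nonzero determinants exclude overlaps along a line, so the single entry also fixes the parameter
    of the crossing. *)
Lemma crossings_le1 : List.forallb (fun t => Nat.leb (List.length (crossings t)) 1 &&
  List.forallb (fun c => ~~ (seg_det t c.1 =? 0)) (crossings t)) templates.
Proof. by vm_compute. Qed.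

Lemma passes_false : List.forallb (fun t => List.forallb (fun r => List.forallb (fun c =>
  ~~ passes t r c.1 c.2) shifts) (List.seq 0 6)) templates.
Proof. by vm_compute. Qed.

Lemma template_bounds t : List.In t templates ->
  [/\ -5 <= vertex_x (src t) <= 29, -5 <= vertex_x (src t) + seg_dx t <= 29,
      2 <= vertex_y (src t) <= 78, 2 <= vertex_y (src t) + seg_dy t <= 78
    & seg_dy t <> 0].
Proof.
move=> /=; repeat (case; first by move=> <-; rewrite /seg_dx /seg_dy; split=> //=; lia).
by [].
Qed.

Lemma vertex_bounds (r : nat) : (r < 6)%nat -> -5 <= vertex_x r <= 29 /\ 2 <= vertex_y r <= 78.
Proof. by case: r => [|[|[|[|[|[|r]]]]]] //= _; rewrite /vertex_x /vertex_y /=; lia. Qed.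

(** The six abscissas are distinct modulo 20, so the column alone determines the residue. *)
Lemma vertex_residue_inj (r r' : nat) k j : (r < 6)%nat -> (r' < 6)%nat ->
  vertex_x r = vertex_x r' + 20 * j -> vertex_y r = vertex_y r' + 20 * k ->
  r = r' /\ k = 0.
Proof.
by case: r => [|[|[|[|[|[|r]]]]]] // _; case: r' => [|[|[|[|[|[|r']]]]]] // _;
  rewrite /vertex_x /vertex_y /=; lia.
Qed.

Lemma in_shifts k j : -4 < k < 4 -> -2 < j < 2 -> List.In (k, j) shifts.
Proof. move=> hk hj; apply: List.in_prod; rewrite /=; lia. Qed.

End Segments.

(** * Embedding the cylinder in the plane *)

Section Drawing.
Local Open Scope R_scope.

Definition polar (X Y : R) : R * R :=
  (exp Y * cos (PI / 10 * X), exp Y * sin (PI / 10 * X)).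

Lemma polar_inj X Y X' Y' : polar X Y = polar X' Y' ->
  Y = Y' /\ exists j : Z, X = X' + 20 * IZR j.
Proof.
case=> hc hs.
set a := PI / 10 * X in hc hs; set b := PI / 10 * X' in hc hs.
have ha := sin2_cos2 a; have hb := sin2_cos2 b; rewrite /Rsqr in ha hb.
(* The squared norm of [polar X Y] is exp(2Y). *)
have hY : Y = Y'.
  have : exp (Y + Y) = exp (Y' + Y').
    rewrite !exp_plus.
    transitivity ((exp Y * cos a) * (exp Y * cos a) + (exp Y * sin a) * (exp Y * sin a)).
      by transitivity (exp Y * exp Y * (sin a * sin a + cos a * cos a));
        [rewrite ha; ring | ring].
    rewrite hc hs.
    by transitivity (exp Y' * exp Y' * (sin b * sin b + cos b * cos b));
      [ring | rewrite hb; ring].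
  by move/exp_inv; lra.
split=> //; subst Y'.
have e0 : exp Y <> 0 by have := exp_pos Y; lra.
have {}hc := Rmult_eq_reg_l _ _ _ hc e0; have {}hs := Rmult_eq_reg_l _ _ _ hs e0.
(* The half-angle formula turns cos(a - b) = 1 into sin((a - b)/2) = 0, so (a - b)/2 is a multiple
   of [PI]. *)
have hd : cos (2 * ((a - b) / 2)) = 1.
  have -> : 2 * ((a - b) / 2) = a - b by field.
  by rewrite cos_minus hc hs; lra.
rewrite cos_2a_sin in hd.
have [|j hj] := @sin_eq_0_0 ((a - b) / 2); first by nra.
exists j; have hpi := PI_RGT_0.
have : a - b = 2 * IZR j * PI by lra.
rewrite /a /b => h.
have : PI * X = PI * (X' + 20 * IZR j) by lra.
by move/Rmult_eq_reg_l; apply; lra.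
Qed.

Lemma polar_turn X Y (w : Z) : polar (X + 20 * IZR w) Y = polar X Y.
Proof.
have H (m : nat) Z : polar (Z + 20 * INR m) Y = polar Z Y.
  rewrite /polar.
  have -> : PI / 10 * (Z + 20 * INR m) = PI / 10 * Z + 2 * INR m * PI by field.
  by rewrite cos_period sin_period.
have [hw|hw] := Z.le_gt_cases 0 w.
  by rewrite -(H (Z.to_nat w) X) INR_IZR_INZ Znat.Z2Nat.id.
rewrite -(H (Z.to_nat (- w)) (X + _)) INR_IZR_INZ Znat.Z2Nat.id; last by lia.
by rewrite opp_IZR; congr polar; ring.
Qed.

Definition seg_x (t : template) (s : R) : R :=
  IZR (vertex_x (src t)) + s * IZR (seg_dx t).
Definition seg_y (t : template) (s : R) : R :=
  IZR (vertex_y (src t)) + s * IZR (seg_dy t).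

Lemma convex_range lo hi x d s : 0 < s < 1 ->
  lo <= x -> x <= hi -> lo <= x + d -> x + d <= hi -> lo <= x + s * d <= hi.
Proof.
move=> hs h1 h2 h3 h4; have -> : x + s * d = (1 - s) * x + s * (x + d) by ring.
by split; nra.
Qed.

Lemma seg_range t s : List.In t templates -> 0 < s < 1 ->
  -5 <= seg_x t s <= 29 /\ 2 <= seg_y t s <= 78.
Proof.
move=> /template_bounds [[/IZR_le h1 /IZR_le h2] [/IZR_le h3 /IZR_le h4]
  [/IZR_le h5 /IZR_le h6] [/IZR_le h7 /IZR_le h8] _] hs.
rewrite plus_IZR in h3 h4; rewrite plus_IZR in h7 h8.
by split; apply: convex_range.
Qed.

Lemma shift_bounds (k j : Z) x y x' y' :
  -5 <= x <= 29 -> 2 <= y <= 78 -> -5 <= x' <= 29 -> 2 <= y' <= 78 ->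
  x = x' + 20 * IZR j -> y = y' + 20 * IZR k -> List.In (k, j) shifts.
Proof.
move=> *; apply: in_shifts; split; apply: lt_IZR; lra.
Qed.

Lemma cramer ux uy vx vy wx wy s s' : s * ux - s' * vx = wx -> s * uy - s' * vy = wy ->
  s * (ux * vy - uy * vx) = wx * vy - wy * vx /\
  s' * (ux * vy - uy * vx) = wx * uy - wy * ux.
Proof. by move=> <- <-; split; ring. Qed.

Lemma seg_meet_hits t t' (k j : Z) s s' : 0 < s < 1 -> 0 < s' < 1 ->
  seg_x t s = seg_x t' s' + 20 * IZR j -> seg_y t s = seg_y t' s' + 20 * IZR k ->
  hits t t' k j /\ s * IZR (seg_det t t') = IZR (seg_num t t' k j t').
Proof.
rewrite /seg_x /seg_y => hs hs' hx hy.
have [e1 e2] : s * IZR (seg_det t t') = IZR (seg_num t t' k j t') /\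
    s' * IZR (seg_det t t') = IZR (seg_num t t' k j t).
  move: hx hy; rewrite /seg_det /seg_num.
  move: (vertex_x _) (vertex_x _) (vertex_y _) (vertex_y _) (seg_dx _) (seg_dx _)
    (seg_dy _) (seg_dy _) => x x' y y' dx dx' dy dy' hx hy.
  by rewrite !(minus_IZR, mult_IZR, plus_IZR); apply: cramer; lra.
split=> //; rewrite /hits; case: Z.eqb_spec => [D0|/not_0_IZR D0].
  by apply/Z.eqb_spec/eq_IZR; rewrite -e2 D0; ring.
move: (seg_num _ _ _ _ _) (seg_num _ _ _ _ _) (seg_det _ _) e1 e2 D0 => m m' D e1 e2 D0.
have D2 : 0 < IZR D * IZR D by nra.
by apply/and4P; split; apply/Z.ltb_lt/lt_IZR; rewrite !mult_IZR -?e1 -?e2; nra.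
Qed.

Lemma seg_avoids_vertex t r (k j : Z) s : List.In t templates -> (r < 6)%nat ->
  0 < s < 1 -> seg_x t s = IZR (vertex_x r) + 20 * IZR j ->
  seg_y t s = IZR (vertex_y r) + 20 * IZR k -> False.
Proof.
move=> tin hr hs hx hy.
have [rx ry] := seg_range tin hs; have [[v1 v2] [v3 v4]] := vertex_bounds hr.
move/IZR_le in v1; move/IZR_le in v2; move/IZR_le in v3; move/IZR_le in v4.
have kj : List.In (k, j) shifts by apply: shift_bounds rx ry _ _ hx hy; lra.
have [_ _ _ _ /not_0_IZR dy0] := template_bounds tin.
have := proj1 (List.forallb_forall _ _) passes_false t tin.
move/List.forallb_forall => /(_ r); rewrite List.in_seq => /(_ ltac:(lia)).
move/List.forallb_forall => /(_ _ kj) /negP; apply; rewrite /passes /=.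
move: hx hy dy0; rewrite /seg_x /seg_y.
move: (vertex_x (src t)) (vertex_x r) (vertex_y (src t)) (vertex_y r).
move: (seg_dx t) (seg_dy t) => dx dy x x' y y' hx hy dy0.
have ex : IZR (x' + 20 * j - x) = s * IZR dx.
  by rewrite minus_IZR plus_IZR mult_IZR; lra.
have ey : IZR (y' + 20 * k - y) = s * IZR dy.
  by rewrite minus_IZR plus_IZR mult_IZR; lra.
have D2 : 0 < IZR dy * IZR dy by nra.
by apply/and3P; split; [apply/Z.eqb_spec/eq_IZR | apply/Z.ltb_lt/lt_IZR..];
  rewrite !mult_IZR ?ex ?ey; [ring | nra..].
Qed.

Definition vertex_pos (a : nat) : R * R :=
  polar (IZR (vertex_x (a %% 6)))
        (IZR (vertex_y (a %% 6)) + 20 * IZR (Z.of_nat (a %/ 6))).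

Definition edge_arc (a b : nat) (s : R) : R * R :=
  polar (seg_x (template_of a b) s)
        (seg_y (template_of a b) s + 20 * IZR (Z.of_nat (a %/ 6))).

Lemma vertex_pos_inj a b : vertex_pos a = vertex_pos b -> a = b.
Proof.
move=> /polar_inj [hy [j hx]].
have [||||] := @vertex_residue_inj (a %% 6) (b %% 6)
  (Z.of_nat (b %/ 6) - Z.of_nat (a %/ 6)) j.
- exact: ltn_pmod.
- exact: ltn_pmod.
- by apply: eq_IZR; rewrite plus_IZR mult_IZR.
- by apply: eq_IZR; rewrite plus_IZR mult_IZR minus_IZR; lra.
- lia.
Qed.

Lemma edge_arc_continuous a b : continuous_curve (edge_arc a b).
Proof. by move=> s; rewrite /edge_arc /polar /seg_x /seg_y /=; split; reg. Qed.

Lemma edge_arc0 a b : arrow a b -> edge_arc a b 0 = vertex_pos a.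
Proof.
move=> /template_ofP [_ /and3P [/eqP ha _ _]].
by rewrite /edge_arc /vertex_pos /seg_x /seg_y ha; congr polar; ring.
Qed.

Lemma edge_arc1 a b : arrow a b -> edge_arc a b 1 = vertex_pos b.
Proof.
move=> /template_ofP [_ /and3P [_ /eqP hb /eqP hd]].
rewrite /edge_arc /vertex_pos hb hd.
(* The lifted segment ends [wind] turns away from the chosen lift of [b], which is the same point of
   the plane. *)
rewrite -(polar_turn (IZR (vertex_x _)) _ (wind (template_of a b))).
rewrite /seg_x /seg_y /seg_dx /seg_dy Znat.Nat2Z.inj_add.
by rewrite !(plus_IZR, minus_IZR, mult_IZR); congr polar; ring.
Qed.

(** No template is horizontal, so the height, which the point of the plane determines, is strictly
    monotone along an arc. *)
Lemma edge_arc_inj a b s s' : arrow a b -> edge_arc a b s = edge_arc a b s' -> s = s'.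
Proof.
move=> /template_ofP [tin _] /polar_inj [hy _].
have [_ _ _ _ /not_0_IZR dy0] := template_bounds tin.
by apply: (Rmult_eq_reg_r (IZR (seg_dy (template_of a b)))) => //;
  move: hy; rewrite /seg_y; lra.
Qed.

Lemma edge_arc_avoids a b c s : arrow a b -> 0 < s < 1 -> edge_arc a b s <> vertex_pos c.
Proof.
move=> /template_ofP [tin _] hs /polar_inj [hy [j hx]].
apply: (@seg_avoids_vertex _ (c %% 6) (Z.of_nat (c %/ 6) - Z.of_nat (a %/ 6)) j s tin) => //.
  exact: ltn_pmod.
by rewrite minus_IZR; lra.
Qed.

(** The periods of [a] and [c] fix the vertical shift, while the number [x] of turns is only known
    to exist, by [polar_inj]. The equation serves to recover [s] from the entry. *)
Lemma edge_arc_cross a b c d s s' : arrow a b -> arrow c d -> (a, b) <> (c, d) ->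
  0 < s < 1 -> 0 < s' < 1 -> edge_arc a b s = edge_arc c d s' ->
  exists x, let k := (Z.of_nat (c %/ 6) - Z.of_nat (a %/ 6))%Z in
    List.In (template_of c d, (k, x)) (crossings (template_of a b)) /\
    s * IZR (seg_det (template_of a b) (template_of c d)) =
      IZR (seg_num (template_of a b) (template_of c d) k x (template_of c d)).
Proof.
move=> /template_ofP [tin /and3P [/eqP ha /eqP hb /eqP hab]].
move=> /template_ofP [tin' /and3P [/eqP hc /eqP hd /eqP hcd]] ne hs hs'.
move=> /polar_inj [hy [j hx]]; exists j => k.
have {}hy : seg_y (template_of a b) s = seg_y (template_of c d) s' + 20 * IZR k.
  by rewrite /k minus_IZR; lra.
have [h e] := seg_meet_hits hs hs' hx hy; split=> //.
have [rx ry] := seg_range tin hs; have [rx' ry'] := seg_range tin' hs'.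
apply/List.filter_In; split.
  by apply: List.in_prod => //; apply: shift_bounds rx ry rx' ry' hx hy.
rewrite h andbT; apply/negP => /andP [/and3P [/eqP s1 /eqP s2 /eqP s3] /Z.eqb_spec k0].
by apply: ne; congr pair; lia.
Qed.

(* Both intersections are recorded in the list of crossings of the template of
   [(a, b)], which has at most one entry. *)
Lemma edge_arc_cross_uniq a b c d c' d' s s1 t t1 : arrow a b ->
  arrow c d -> arrow c' d' -> (a, b) <> (c, d) -> (a, b) <> (c', d') ->
  0 < s < 1 -> 0 < t < 1 -> 0 < s1 < 1 -> 0 < t1 < 1 ->
  edge_arc a b s = edge_arc c d t -> edge_arc a b s1 = edge_arc c' d' t1 ->
  [/\ c' = c, d' = d & s1 = s].
Proof.
move=> ab cd cd' ne ne' hs ht hs1 ht1 e e'.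
have [x [i h]] := edge_arc_cross ab cd ne hs ht e.
have [x' [i' h']] := edge_arc_cross ab cd' ne' hs1 ht1 e'.
have [tin _] := template_ofP ab.
have := proj1 (List.forallb_forall _ _) crossings_le1 _ tin => /andP [le1 det0].
have D0 := proj1 (List.forallb_forall _ _) det0 _ i.
move: D0 => /Z.eqb_spec/not_0_IZR /= D0.
move: i i' le1; case: (crossings _) => [//|q [|//]] [->|//] [] // [et ek ex] _.
have [_ /and3P [/eqP hc /eqP hd /eqP hcd]] := template_ofP cd.
have [_ /and3P [/eqP hc' /eqP hd' /eqP hcd']] := template_ofP cd'.
rewrite -et -ek -ex -h in h'.
rewrite et in hc hd hcd.
by split; [lia | lia | exact: Rmult_eq_reg_r h' D0].
Qed.

End Drawing.

(** * The finite graphs *)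

Definition graph (n : nat) : rel 'I_n := fun x y => linked x y.

Lemma edge_of_graph n (p : 'I_n * 'I_n) : edge_of (@graph n) p = arrow p.1 p.2.
Proof.
rewrite /edge_of /graph /linked; apply/andP/idP => [[lt /orP []] //|h].
  by move=> /arrow_lt; rewrite ltnNge ltnW.
by rewrite (arrow_lt h) h.
Qed.

Lemma graph_simple n : simple_graph (@graph n).
Proof. by split=> [x y|x]; rewrite /graph ?linked_irr // linked_sym. Qed.

Lemma graph_1_planar n : k_planar (@graph n) 1.
Proof.
exists (fun x : 'I_n => vertex_pos x), (fun p : 'I_n * 'I_n => edge_arc p.1 p.2).
split; [|split].
- by move=> x y /vertex_pos_inj/val_inj.
- move=> p; rewrite edge_of_graph => h; split; first exact: edge_arc_continuous.
  split; first exact: edge_arc0.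
  split; first exact: edge_arc1.
  split=> [s t _ _|s w hs]; first exact: edge_arc_inj.
  exact: edge_arc_avoids.
- move=> p; rewrite edge_of_graph => h.
  pose meets q s := exists t, [/\ arrow (q : 'I_n * 'I_n).1 q.2, q <> p,
    (0 < s < 1)%R, (0 < t < 1)%R & edge_arc p.1 p.2 s = edge_arc q.1 q.2 t].
  have neq (q : 'I_n * 'I_n) : q <> p -> (p.1 : nat, p.2 : nat) <> (q.1 : nat, q.2 : nat).
    by case: p q {h meets} => [a b] [c d] ne [/val_inj ac /val_inj bd]; apply: ne; rewrite ac bd.
  (* Classical case split: if the edge is crossed, any one crossing makes up the whole list. *)
  have [[q [s [t [hq ne hs ht e]]]]|none] := classic (exists q s, meets q s).
    exists [:: (q, s)]; split=> // q' s' t'; rewrite edge_of_graph => hq' ne' hs' ht' e'.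
    left; have [c d ->] := edge_arc_cross_uniq h hq hq' (neq _ ne) (neq _ ne')
      hs ht hs' ht' e e'.
    congr pair; case: q q' c d {hq ne e hq' ne' e'} => [c d] [c' d'] /= /val_inj -> /val_inj -> //.
  exists [::]; split=> // q s t; rewrite edge_of_graph => hq ne hs ht e.
  by case: none; exists q, s, t.
Qed.

Lemma graph_girth n : 17 <= n -> girth_eq (@graph n) 5.
Proof.
case: n => [//|n] hn; split=> //; split.
  (* Residues 0, 5, 4, 1, 5 in periods 0, 0, 2, 1, 1; the largest index 16 accounts for the bound
     17. *)
  pose s := [:: 0; 5; 16; 7; 11].
  have sn : all (fun a => a < n.+1) s by rewrite /=; lia.
  have vs : map (@nat_of_ord n.+1) (map inord s) = s.
    by rewrite -map_comp; apply: map_id_in => a /(allP sn); exact: inordK.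
  exists (map inord s); split=> //; first by rewrite -(map_inj_uniq val_inj) vs.
  have : cycle linked (map (@nat_of_ord n.+1) (map inord s)) by rewrite vs.
  by rewrite cycle_map.
move=> k hk [s [sk us cs]]; have /orP [/eqP k3|/eqP k4] : (k == 3) || (k == 4) by lia.
  case: s sk us cs; rewrite k3 => // a [|b [|c []]] //= _ _ /and4P [ab bc ca _].
  exact: linked_triangle_free ab bc ca.
case: s sk us cs; rewrite k4 => // a [|b [|c [|d []]]] //= _.
rewrite !inE => /and4P [/norP [_ /norP [ac _]] /norP [_ bd] _ _] /and5P [ab bc cd da _].
apply: linked_square_free ab bc cd da => /val_inj e; first by rewrite e eqxx in ac.
by rewrite e eqxx in bd.
Qed.

(** Rises are at most 2, so all 13 edges starting in a period [k] with [k + 2 < n %/ 6] end below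
    [n]; the injection [f] enumerates these. *)
Lemma graph_num_edges n : 13 * (n %/ 6 - 2) <= num_edges (@graph n).
Proof.
case: n => [//|n]; move eqK: (n.+1 %/ 6 - 2) => K.
pose t0 := Template 0 0 0 0.
pose tm (i : 'I_13) := nth t0 templates i.
pose f (x : 'I_13 * 'I_K) : 'I_n.+1 * 'I_n.+1 :=
  (inord (6 * x.2 + src (tm x.1)), inord (6 * (x.2 + rise (tm x.1)) + dst (tm x.1))).
have tmP i : [/\ src (tm i) < 6, dst (tm i) < 6 & rise (tm i) <= 2].
  have H : all (fun t => [&& src t < 6, dst t < 6 & rise t <= 2]) templates by vm_compute.
  by apply/and3P; apply: (all_nthP t0 H); exact: ltn_ord.
have fE x : ((f x).1 = 6 * x.2 + src (tm x.1) :> nat) *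
            ((f x).2 = 6 * (x.2 + rise (tm x.1)) + dst (tm x.1) :> nat).
  have [h1 h2 h3] := tmP x.1; have h4 := ltn_ord x.2.
  by split; rewrite inordK //; lia.
have finj : injective f.
  move=> x y e; have [h1 h2 h3] := tmP x.1; have [h1' h2' h3'] := tmP y.1.
  have e1 : (f x).1 = (f y).1 :> nat by rewrite e.
  have e2 : (f x).2 = (f y).2 :> nat by rewrite e.
  rewrite !fE in e1 e2.
  have eK : x.2 = y.2 by apply: val_inj => /=; lia.
  (* Within one period the two end points reveal [(src, dst, rise)], and these keys are pairwise
     distinct. *)
  have U : uniq (map (fun t => (src t, dst t, rise t)) templates) by vm_compute.
  suff : x.1 = y.1 by case: x y eK {e e1 e2 h1 h2 h3 h1' h2' h3'} => [? ?] [? ?] /= -> ->.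
  apply/val_inj/eqP; rewrite -(nth_uniq (0, 0, 0) _ _ U); try exact: ltn_ord.
  rewrite !(nth_map t0); try exact: ltn_ord.
  rewrite -!/(tm _) eK in e2 e1 *.
  by apply/eqP; congr (_, _, _); lia.
have -> : 13 * K = #|f @: setT| by rewrite card_imset // cardsT card_prod !card_ord.
apply/subset_leq_card/subsetP => _ /imsetP [x _ ->]; rewrite inE edge_of_graph.
apply/List.existsb_exists; exists (tm x.1).
have [h1 h2 h3] := tmP x.1; split.
  by move: x.1 => [i /=]; do 13 (case: i => [|i]; first by move=> ?; rewrite /tm /=; tauto).
rewrite /matches !fE; move: h1 h2 h3 => /=; move: (src _) (dst _) (rise _) (nat_of_ord _).
by move=> u v d k h1 h2 h3; apply/and3P; split; apply/eqP; lia.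
Qed.

Theorem theorem9 :
  exists C : R, exists N : nat, forall n : nat, (N <= n)%N ->
    exists e : rel 'I_n,
      simple_graph e /\ k_planar e 1 /\ girth_eq e 5 /\
      (INR (num_edges e) >= (2 + 1/6) * INR n - C)%R.
Proof.
(* 17 lets the 5-cycle fit. As 6 * (n %/ 6) >= n - 5, six times the edge count is at least 13 * n -
   65 - 156, hence at least 13 * n - 6 * 40. *)
exists 40%R, 17 => n hn; exists (@graph n); split; first exact: graph_simple.
split; first exact: graph_1_planar.
split; first exact: graph_girth.
have /leP/le_INR h : 13 * n <= 6 * num_edges (@graph n) + 240.
  by have := graph_num_edges n; lia.
move: h; rewrite -plusE -!multE plus_INR !mult_INR.
by rewrite !(INR_IZR_INZ 13, INR_IZR_INZ 6, INR_IZR_INZ 240) /=; lra.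
Qed.
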